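(* Let $k$ be a field and let $A$ be a Poisson superalgebra over $k$ with associative product $*$, Lie superbracket $\{\,,\,\}$, and a unity $1=1_A$ for the product $*$, such that $\{x,1_A\}=0$ for all $x\in A$. Define $k$-linear maps $W,X,Z:A\otimes A\to A\otimes A$ by the following formulas on homogeneous $x,y\in A$ (extended linearly): $$W(x\otimes y)=\{x,y\}\otimes 1+(-1)^{|x||y|}\,x\otimes y,$$ $$X(x\otimes y)=1\otimes\{x,y\}+(-1)^{|x||y|}\,x\otimes y,$$ $$Z(x\otimes y)=1\otimes (x*y)+(x*y)\otimes 1-y\otimes x.$$ Then $(W,X,Z)$ is a $WXZ$-system, that is, $$[W,W,W]=0,\qquad [Z,Z,Z]=0,\qquad [W,X,X]=0,\qquad [X,X,Z]=0,$$ where $[R,S,T]=R^{12}S^{13}T^{23}-T^{23}S^{13}R^{12}$ denotes the Yang-Baxter commutator, an endomorphism of $A\otimes A\otimes A$.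
   Context: All tensor products are over $k$. For a vector space $V$, $I$ is the identity map and $\tau:V\otimes V\to V\otimes V$ is the ordinary (unsigned) twist $\tau(v\otimes w)=w\otimes v$. For a $k$-linear map $R:V\otimes V\to V\otimes V$, define on $V\otimes V\otimes V$: $R^{12}=R\otimes I$, $R^{23}=I\otimes R$, $R^{13}=(I\otimes\tau)(R\otimes I)(I\otimes\tau)$ (ordinary tensor products of linear maps, without Koszul signs). Juxtaposition of operators is composition. For a $\mathbb{Z}_2$-graded vector space, $|x|\in\mathbb{Z}_2$ denotes the degree of a homogeneous element $x$. A Lie superalgebra is a $\mathbb{Z}_2$-graded vector space with a bilinear bracket that respects the grading ($|\{x,y\}|=|x|+|y|$), is super-skew-symmetric, $\{x,y\}=-(-1)^{|x||y|}\{y,x\}$, and satisfies the super Jacobi identity $\{x,\{y,w\}\}=\{\{x,y\},w\}+(-1)^{|x||y|}\{y,\{x,w\}\}$ for homogeneous $x,y,w$. A Poisson superalgebra is an associative superalgebra $(A,* )$ (a $\mathbb{Z}_2$-graded associative algebra whose product respects the grading) together with a bracket $\{\,,\,\}:A\otimes A\to A$ such that $(A,\{\,,\,\})$ is a Lie superalgebra and, for every homogeneous $x$, the operator $\{x,\cdot\}:A\to A$ is a superderivation: $\{x,y*w\}=\{x,y\}*w+(-1)^{|x||y|}\,y*\{x,w\}$ for homogeneous $y,w\in A$. Supercommutativity of $*$ is not part of this definition. *)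

(* Defs.v *)
From HB Require Import structures.
From mathcomp Require Import all_boot all_order all_algebra.
From mathcomp Require Import boolp freeg.

Set Implicit Arguments.
Unset Strict Implicit.
Unset Printing Implicit Defensive.

Import GRing.Theory.
Local Open Scope ring_scope.
Local Open Scope quotient_scope.

Reserved Notation "U ⊗ V" (at level 40, left associativity).
Reserved Notation "u ⊗t v" (at level 40, left associativity).
Reserved Notation "x ** y" (at level 40, left associativity).
Reserved Notation "⟨ x , y ⟩" (at level 0, x at level 99, y at level 99,
  format "⟨ x ,  y ⟩").

Section FreegLift.
Variables (k : fieldType) (K : choiceType) (M : lmodType k) (f : K -> M).

Lemma fglift_is_linear : linear (fglift f : {freeg K / k} -> M).
Proof.
have fgB : zmod_morphism (fglift f : {freeg K / k} -> M) by exact: lift_is_additive.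
have fg0 : fglift f (0 : {freeg K / k}) = 0 by rewrite -(subrr 0) fgB subrr.
have fgN D : fglift f (- D : {freeg K / k}) = - fglift f D.
  by rewrite -[- D]sub0r fgB fg0 sub0r.
have fgD D E : fglift f (D + E : {freeg K / k}) = fglift f D + fglift f E.
  by rewrite -[E in LHS]opprK fgB fgN opprK.
move=> a D E; rewrite fgD; congr (_ + _).
have -> : a *: D = \sum_(x <- dom D) << a * coeff x D *g x >> by [].
rewrite (big_morph (fglift f) fgD fg0).
have -> : fglift f D = \sum_(x <- dom D) coeff x D *: f x.
  by rewrite -[in LHS](Freeg_dom D) fglift_Freeg /prelift [LHS]big_map.
by rewrite scaler_sumr; apply: eq_bigr => x _; rewrite liftU scalerA.
Qed.

End FreegLift.

Section TensorDef.
Variables (k : fieldType) (U V : lmodType k).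

Local Notation F := {freeg (U * V)%type / k}.

Definition tgen (u : U) (v : V) : F := << (u, v) >>.

Definition tensor_relator (D : F) : Prop :=
  (exists a u u' v, D = tgen (a *: u + u') v - (a *: tgen u v + tgen u' v)) \/
  (exists a u v v', D = tgen u (a *: v + v') - (a *: tgen u v + tgen u v')).

(* The span of the relators, as the smallest subspace containing them. *)
Definition tensor_null : {pred F} := fun D =>
  `[< forall S : {pred F}, submod_closed S ->
        (forall E, tensor_relator E -> E \in S) -> D \in S >].

Lemma tensor_null_relator D : tensor_relator D -> D \in tensor_null.
Proof. by move=> relD; apply/asboolP => S _; apply. Qed.

Lemma tensor_null_submod : submod_closed tensor_null.
Proof.
split; first by apply/asboolP => S [].
move=> a D E /asboolP nD /asboolP nE; apply/asboolP => S clS relS.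
by case: (clS) => _; apply; [apply: nD | apply: nE].
Qed.

HB.instance Definition _ :=
  GRing.isZmodClosed.Build F tensor_null (GRing.submod_closedB tensor_null_submod).

Definition tensor : Type := {ideal_quot tensor_null}.

HB.instance Definition _ := Choice.on tensor.
HB.instance Definition _ := GRing.Zmodule.on tensor.

Definition tproj (D : F) : tensor := \pi_({ideal_quot tensor_null}) D.

Lemma tproj_eq D E : (tproj D == tproj E) = (D - E \in tensor_null).
Proof. by rewrite /tproj Quotient.idealrBE. Qed.

Lemma tproj_repr (t : tensor) : tproj (repr (t : {ideal_quot tensor_null})) = t.
Proof. exact: reprK. Qed.

Lemma tprojD D E : tproj (D + E) = tproj D + tproj E.
Proof. by rewrite /tproj piE. Qed.

Definition tscale (a : k) (t : tensor) : tensor :=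
  tproj (a *: repr (t : {ideal_quot tensor_null})).

Lemma tproj_scale a D : tproj (a *: D) = tscale a (tproj D).
Proof.
apply/eqP; rewrite tproj_eq -scalerBr.
suff DE : D - repr (tproj D : {ideal_quot tensor_null}) \in tensor_null.
  case: tensor_null_submod => n0 nL.
  by rewrite -[_ *: _]addr0; apply: nL.
by rewrite -tproj_eq tproj_repr.
Qed.

Lemma tscaleA a b t : tscale a (tscale b t) = tscale (a * b) t.
Proof. by rewrite -[t]tproj_repr -!tproj_scale scalerA. Qed.

Lemma tscale1 : left_id 1 tscale.
Proof. by move=> t; rewrite -[t]tproj_repr -tproj_scale scale1r. Qed.

Lemma tscaleDr : right_distributive tscale +%R.
Proof.
move=> a s t; rewrite -[s]tproj_repr -[t]tproj_repr -tprojD -!tproj_scale.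
by rewrite scalerDr tprojD.
Qed.

Lemma tscaleDl t : {morph tscale^~ t : a b / a + b}.
Proof. by move=> a b; rewrite -[t]tproj_repr -!tproj_scale scalerDl tprojD. Qed.

HB.instance Definition _ := GRing.Zmodule_isLmodule.Build k tensor
  tscaleA tscale1 tscaleDr tscaleDl.

Lemma tproj_is_linear : linear tproj.
Proof. by move=> a D E; rewrite tprojD tproj_scale. Qed.

Definition tpure (u : U) (v : V) : tensor := tproj (tgen u v).

Lemma tpure_is_bilinear :
  bilinear_for *:%R *:%R tpure.
Proof.
split=> [v a u u' | u a v v'] /=; apply/eqP;
  rewrite -tproj_is_linear tproj_eq; apply: tensor_null_relator.
- by left; exists a, u, u', v.
- by right; exists a, u, v, v'.
Qed.

HB.instance Definition _ :=
  bilinear_isBilinear.Build k U V tensor _ _ tpure tpure_is_bilinear.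

Section Lift.
Variables (T : lmodType k) (f : {bilinear U -> V -> T}).

Let g : F -> T := fglift (fun p : U * V => f p.1 p.2).

Lemma tlift_null D : D \in tensor_null -> g D = 0.
Proof.
have gL : linear g by exact: fglift_is_linear.
pose gl : {linear F -> T} := HB.pack g (GRing.isLinear.Build _ _ _ _ g gL).
have gE u v : gl (tgen u v) = f u v.
  by rewrite /= /g /tgen liftU scale1r.
move/asboolP/(_ [pred E | gl E == 0]) => nD; apply/eqP; apply: nD.
  split=> [|a E E']; rewrite !inE ?linear0 //.
  by move=> /eqP E0 /eqP E'0; rewrite linearP E0 E'0 scaler0 addr0.
move=> E [[a [u [u' [v ->]]]] | [a [u [v [v' ->]]]]];
  rewrite inE linearB linearP !gE.
- by rewrite linearPl subrr.
- by rewrite linearPr subrr.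
Qed.

Definition tlift (t : tensor) : T := g (repr (t : {ideal_quot tensor_null})).

Lemma tlift_proj D : tlift (tproj D) = g D.
Proof.
have gL : linear g by exact: fglift_is_linear.
pose gl : {linear F -> T} := HB.pack g (GRing.isLinear.Build _ _ _ _ g gL).
apply/eqP; rewrite -subr_eq0 -[_ - _](linearB gl).
by apply/eqP/tlift_null; rewrite -tproj_eq tproj_repr.
Qed.

Lemma tlift_is_linear : linear tlift.
Proof.
move=> a s t; rewrite -[s]tproj_repr -[t]tproj_repr -tproj_is_linear.
by rewrite !tlift_proj [LHS]fglift_is_linear.
Qed.

HB.instance Definition _ :=
  GRing.isLinear.Build k tensor T *:%R tlift tlift_is_linear.

Lemma tliftE u v : tlift (tpure u v) = f u v.
Proof. by rewrite tlift_proj /g liftU scale1r. Qed.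

End Lift.

Lemma tensor_ind (P : tensor -> Prop) :
    P 0 -> (forall a u v t, P t -> P (a *: tpure u v + t)) ->
  forall t, P t.
Proof.
move=> P0 PD t; rewrite -[t]tproj_repr; move: (repr _) => D.
pose pl : {linear F -> tensor} :=
  HB.pack tproj (GRing.isLinear.Build _ _ _ _ tproj tproj_is_linear).
have -> : D = \sum_(x <- dom D) coeff x D *: (<< x >> : F).
  rewrite -[LHS]freeg_sumE; apply: eq_bigr => x _.
  by apply/eqP/freeg_eqP => y; rewrite coeff_fgscale !coeffU mul1r.
rewrite -[tproj _]/(pl _) linear_sum.
elim: (dom D) => [|[u v] s IHs]; first by rewrite big_nil.
by rewrite big_cons linearZ; apply: PD.
Qed.

Lemma tensor_linear_ext (T : lmodType k) (f g : {linear tensor -> T}) :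
  (forall u v, f (tpure u v) = g (tpure u v)) -> f =1 g.
Proof.
move=> fg t; elim/tensor_ind: t => [|a u v t IHt]; first by rewrite !linear0.
by rewrite !linearP IHt fg.
Qed.

End TensorDef.

Notation "U ⊗ V" := (tensor U V) : type_scope.
Notation "u ⊗t v" := (tpure u v) : ring_scope.

Arguments tlift : simpl never.
Arguments tpure : simpl never.

Section TensorMap.
Variables (k : fieldType) (U V U' V' : lmodType k).
Variables (f : {linear U -> U'}) (g : {linear V -> V'}).

Definition tmap_bil (u : U) (v : V) : (U' ⊗ V')%type := f u ⊗t g v.

Lemma tmap_bil_is_bilinear :
  bilinear_for *:%R *:%R tmap_bil.
Proof.
by split=> [v a u u' | u a v v'] /=;
  rewrite /tmap_bil linearP ?linearPl ?linearPr.
Qed.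

HB.instance Definition _ := bilinear_isBilinear.Build k U V (U' ⊗ V')%type
  _ _ tmap_bil tmap_bil_is_bilinear.

Definition tmap : {linear (U ⊗ V)%type -> (U' ⊗ V')%type} := tlift tmap_bil.

Lemma tmapE u v : tmap (u ⊗t v) = f u ⊗t g v.
Proof. exact: tliftE. Qed.

End TensorMap.

Section Twist.
Variables (k : fieldType) (U V : lmodType k).

Definition twist_bil (u : U) (v : V) : (V ⊗ U)%type := v ⊗t u.

Lemma twist_bil_is_bilinear :
  bilinear_for *:%R *:%R twist_bil.
Proof.
by split=> [v a u u' | u a v v'] /=; rewrite /twist_bil ?linearPl ?linearPr.
Qed.

HB.instance Definition _ := bilinear_isBilinear.Build k U V (V ⊗ U)%type
  _ _ twist_bil twist_bil_is_bilinear.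

Definition twist : {linear (U ⊗ V)%type -> (V ⊗ U)%type} := tlift twist_bil.

Lemma twistE u v : twist (u ⊗t v) = v ⊗t u.
Proof. exact: tliftE. Qed.

End Twist.

Section Associator.
Variables (k : fieldType) (U V W : lmodType k).

Definition tassoc_inner (w : W) (u : U) (v : V) : (U ⊗ (V ⊗ W))%type :=
  u ⊗t (v ⊗t w).

Lemma tassoc_inner_is_bilinear w :
  bilinear_for *:%R *:%R (tassoc_inner w).
Proof.
by split=> [v a u u' | u a v v'] /=;
  rewrite /tassoc_inner ?linearPl ?linearPr.
Qed.

HB.instance Definition _ w := bilinear_isBilinear.Build k U V
  (U ⊗ (V ⊗ W))%type _ _ (tassoc_inner w) (tassoc_inner_is_bilinear w).

Definition tassoc_bil (t : (U ⊗ V)%type) (w : W) : (U ⊗ (V ⊗ W))%type :=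
  tlift (tassoc_inner w) t.

Lemma tassoc_bil_is_bilinear :
  bilinear_for *:%R *:%R tassoc_bil.
Proof.
split=> [w a t t' | t a w w'] /=; rewrite /tassoc_bil; first exact: linearP.
elim/tensor_ind: t => [|b u v t IHt]; first by rewrite !linear0 addr0.
have E : tassoc_inner (a *: w + w') u v = a *: tassoc_inner w u v + tassoc_inner w' u v.
  by rewrite /tassoc_inner !linearPr.
rewrite !linearP /= IHt !tliftE /= E.
by rewrite !scalerDr !scalerA [b * a]mulrC addrACA.
Qed.

HB.instance Definition _ := bilinear_isBilinear.Build k (U ⊗ V)%type W
  (U ⊗ (V ⊗ W))%type _ _ tassoc_bil tassoc_bil_is_bilinear.

Definition tassoc : {linear (U ⊗ V ⊗ W)%type -> (U ⊗ (V ⊗ W))%type} :=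
  tlift tassoc_bil.

Lemma tassocE u v w : tassoc (u ⊗t v ⊗t w) = u ⊗t (v ⊗t w).
Proof. by rewrite /tassoc [LHS]tliftE [LHS]tliftE. Qed.

Definition tassocV_inner (u : U) (v : V) (w : W) : (U ⊗ V ⊗ W)%type :=
  u ⊗t v ⊗t w.

Lemma tassocV_inner_is_bilinear u :
  bilinear_for *:%R *:%R (tassocV_inner u).
Proof.
by split=> [w a v v' | v a w w'] /=; rewrite /tassocV_inner ?linearPr ?linearPl.
Qed.

HB.instance Definition _ u := bilinear_isBilinear.Build k V W
  (U ⊗ V ⊗ W)%type _ _ (tassocV_inner u) (tassocV_inner_is_bilinear u).

Definition tassocV_bil (u : U) (t : (V ⊗ W)%type) : (U ⊗ V ⊗ W)%type :=
  tlift (tassocV_inner u) t.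

Lemma tassocV_bil_is_bilinear :
  bilinear_for *:%R *:%R tassocV_bil.
Proof.
split=> [t a u u' | u a t t'] /=; rewrite /tassocV_bil; last exact: linearP.
elim/tensor_ind: t => [|b v w t IHt]; first by rewrite !linear0 addr0.
have E : tassocV_inner (a *: u + u') v w = a *: tassocV_inner u v w + tassocV_inner u' v w.
  by rewrite /tassocV_inner !linearPl.
rewrite !linearP /= IHt !tliftE /= E.
by rewrite !scalerDr !scalerA [b * a]mulrC addrACA.
Qed.

HB.instance Definition _ := bilinear_isBilinear.Build k U (V ⊗ W)%type
  (U ⊗ V ⊗ W)%type _ _ tassocV_bil tassocV_bil_is_bilinear.

Definition tassocV : {linear (U ⊗ (V ⊗ W))%type -> (U ⊗ V ⊗ W)%type} :=
  tlift tassocV_bil.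

Lemma tassocVE u v w : tassocV (u ⊗t (v ⊗t w)) = u ⊗t v ⊗t w.
Proof. by rewrite /tassocV [LHS]tliftE [LHS]tliftE. Qed.

End Associator.

Section YangBaxter.
Variables (k : fieldType) (V : lmodType k).

Local Notation V2 := (V ⊗ V)%type.
Local Notation V3 := (V ⊗ V ⊗ V)%type.

Definition op12 (R : {linear V2 -> V2}) : {linear V3 -> V3} := tmap R idfun.

(* V3 is (V ⊗ V) ⊗ V, so I ⊗ R is transported along the associator. *)
Definition op23 (R : {linear V2 -> V2}) : {linear V3 -> V3} :=
  (tassocV V V V \o tmap idfun R) \o tassoc V V V.

Definition op13 (R : {linear V2 -> V2}) : {linear V3 -> V3} :=
  (op23 (twist V V) \o op12 R) \o op23 (twist V V).

Definition yb_commutator (R S T : {linear V2 -> V2}) : {linear V3 -> V3} :=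
  ((op12 R \o op13 S) \o op23 T) \- ((op23 T \o op13 S) \o op12 R).

Definition WXZ_system (W X Z : {linear V2 -> V2}) : Prop :=
  [/\ yb_commutator W W W =1 \0, yb_commutator Z Z Z =1 \0,
      yb_commutator W X X =1 \0 & yb_commutator X X Z =1 \0].

End YangBaxter.

(* superdeg i is the subspace of homogeneous elements of degree i. *)
HB.mixin Record Lmodule_isSuper (k : fieldType) V of GRing.Lmodule k V := {
  superdeg : 'Z_2 -> {pred V};
  superdeg_submod : forall i, submod_closed (superdeg i);
  superdeg_decomp : forall x, exists! c : {ffun 'Z_2 -> V},
    (forall i, c i \in superdeg i) /\ \sum_i c i = x
}.

#[short(type="superLmodType")]
HB.structure Definition SuperLmodule (k : fieldType) :=
  {V of GRing.Lmodule k V & Lmodule_isSuper k V}.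

Definition supersign (k : fieldType) (i j : 'Z_2) : k := (-1) ^+ (i * j)%N.

HB.mixin Record Super_isAssoc (k : fieldType) A of SuperLmodule k A := {
  smul : A -> A -> A;
  smul_bilinear : bilinear_for *:%R *:%R smul;
  smul_deg : forall (i j : 'Z_2) (x y : A),
    x \in superdeg i -> y \in superdeg j -> smul x y \in superdeg (i + j);
  smulA : associative smul
}.

(* Not assumed to be unital or supercommutative. *)
#[short(type="assocSuperalgType")]
HB.structure Definition AssocSuperalgebra (k : fieldType) :=
  {A of SuperLmodule k A & Super_isAssoc k A}.

HB.mixin Record Super_isLie (k : fieldType) A of SuperLmodule k A := {
  sbracket : A -> A -> A;
  sbracket_bilinear : bilinear_for *:%R *:%R sbracket;
  sbracket_deg : forall (i j : 'Z_2) (x y : A),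
    x \in superdeg i -> y \in superdeg j -> sbracket x y \in superdeg (i + j);
  sbracket_skew : forall (i j : 'Z_2) (x y : A),
    x \in superdeg i -> y \in superdeg j ->
    sbracket x y = - (supersign k i j *: sbracket y x);
  sbracket_jacobi : forall (i j l : 'Z_2) (x y w : A),
    x \in superdeg i -> y \in superdeg j -> w \in superdeg l ->
    sbracket x (sbracket y w) =
      sbracket (sbracket x y) w + supersign k i j *: sbracket y (sbracket x w)
}.

#[short(type="lieSuperalgType")]
HB.structure Definition LieSuperalgebra (k : fieldType) :=
  {A of SuperLmodule k A & Super_isLie k A}.

Notation "x ** y" := (smul x y) : ring_scope.
Notation "⟨ x , y ⟩" := (sbracket x y) : ring_scope.

HB.mixin Record AssocLie_isPoisson (k : fieldType) A
    of AssocSuperalgebra k A & LieSuperalgebra k A := {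
  sbracket_superder : forall (i j l : 'Z_2) (x y w : A),
    x \in superdeg i -> y \in superdeg j -> w \in superdeg l ->
    ⟨x, y ** w⟩ = ⟨x, y⟩ ** w + supersign k i j *: (y ** ⟨x, w⟩)
}.

#[short(type="poissonSuperalgType")]
HB.structure Definition PoissonSuperalgebra (k : fieldType) :=
  {A of AssocSuperalgebra k A & LieSuperalgebra k A & AssocLie_isPoisson k A}.

HB.instance Definition _ (k : fieldType) (A : assocSuperalgType k) :=
  bilinear_isBilinear.Build k A A A _ _ (@smul k A) smul_bilinear.

HB.instance Definition _ (k : fieldType) (A : lieSuperalgType k) :=
  bilinear_isBilinear.Build k A A A _ _ (@sbracket k A) sbracket_bilinear.

Section HomogeneousComponents.
Variables (k : fieldType) (V : superLmodType k).

Lemma superdeg_comp_ex (x : V) : exists c : {ffun 'Z_2 -> V},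
  [forall i, c i \in superdeg i] && (\sum_i c i == x).
Proof.
have [c [[cdeg cx] _]] := superdeg_decomp x.
by exists c; rewrite cx eqxx andbT; apply/forallP.
Qed.

Definition supercomp (i : 'Z_2) (x : V) : V := xchoose (superdeg_comp_ex x) i.

Lemma supercomp_deg i x : supercomp i x \in superdeg i.
Proof. by have /andP[/forallP/(_ i)] := xchooseP (superdeg_comp_ex x). Qed.

Lemma supercomp_sum x : \sum_i supercomp i x = x.
Proof. by have /andP[_ /eqP] := xchooseP (superdeg_comp_ex x). Qed.

Lemma supercomp_unique x (c : 'Z_2 -> V) :
  (forall i, c i \in superdeg i) -> \sum_i c i = x ->
  forall i, supercomp i x = c i.
Proof.
move=> cdeg cx i; have [d [_ dU]] := superdeg_decomp x.
have dE (e : 'Z_2 -> V) : (forall i, e i \in superdeg i) ->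
    \sum_i e i = x -> d = [ffun i => e i].
  move=> edeg ex; apply: dU; split=> [j|]; first by rewrite ffunE.
  by rewrite -[RHS]ex; apply: eq_bigr => j _; rewrite ffunE.
have := dE _ cdeg cx.
rewrite (dE (supercomp^~ x) (supercomp_deg^~ x) (supercomp_sum x)).
by move/ffunP/(_ i); rewrite !ffunE.
Qed.

Lemma supercomp_is_linear i : linear (supercomp i).
Proof.
move=> a x y.
apply: (supercomp_unique (c := fun i => a *: supercomp i x + supercomp i y)).
  by move=> j; apply: (superdeg_submod j).2; exact: supercomp_deg.
by rewrite big_split /= -scaler_sumr !supercomp_sum.
Qed.

HB.instance Definition _ i :=
  GRing.isLinear.Build k V V *:%R (supercomp i) (supercomp_is_linear i).

Lemma supercomp_homog i j x :
  x \in superdeg j -> supercomp i x = if i == j then x else 0.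
Proof.
move=> xj; apply: (supercomp_unique (c := fun i => if i == j then x else 0)).
  by move=> l; case: eqP => [->|_] //; exact: (superdeg_submod l).1.
by rewrite -big_mkcond big_pred1_eq.
Qed.

End HomogeneousComponents.

Section PoissonMaps.
Variables (k : fieldType) (A : poissonSuperalgType k) (one : A).

Local Notation A2 := (A ⊗ A)%type.

(* Sums over homogeneous components extend the formulas, given for homogeneous
   x and y, to all x and y; see WmapE, XmapE and homog_linear_ext. *)
Definition W_bil (x y : A) : A2 :=
  \sum_(i : 'Z_2) \sum_(j : 'Z_2)
    (⟨supercomp i x, supercomp j y⟩ ⊗t one
     + supersign k i j *: (supercomp i x ⊗t supercomp j y)).

Definition X_bil (x y : A) : A2 :=
  \sum_(i : 'Z_2) \sum_(j : 'Z_2)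
    (one ⊗t ⟨supercomp i x, supercomp j y⟩
     + supersign k i j *: (supercomp i x ⊗t supercomp j y)).

Definition Z_bil (x y : A) : A2 :=
  one ⊗t (x ** y) + (x ** y) ⊗t one - y ⊗t x.

Lemma W_bil_is_bilinear :
  bilinear_for *:%R *:%R W_bil.
Proof.
split=> [y a x x' | x a y y'] /=; rewrite /W_bil scaler_sumr -big_split /=;
  apply: eq_bigr => i _; rewrite scaler_sumr -big_split /=;
  apply: eq_bigr => j _.
- rewrite (linearP (supercomp i)) !linearPl /= !scalerDr !scalerA.
  by rewrite [supersign k i j * a]mulrC addrACA.
- rewrite (linearP (supercomp j)) linearPr linearPl linearPr /= !scalerDr !scalerA.
  by rewrite [supersign k i j * a]mulrC addrACA.
Qed.

Lemma X_bil_is_bilinear :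
  bilinear_for *:%R *:%R X_bil.
Proof.
split=> [y a x x' | x a y y'] /=; rewrite /X_bil scaler_sumr -big_split /=;
  apply: eq_bigr => i _; rewrite scaler_sumr -big_split /=;
  apply: eq_bigr => j _.
- rewrite (linearP (supercomp i)) linearPl linearPr linearPl /= !scalerDr !scalerA.
  by rewrite [supersign k i j * a]mulrC addrACA.
- rewrite (linearP (supercomp j)) !linearPr /= !scalerDr !scalerA.
  by rewrite [supersign k i j * a]mulrC addrACA.
Qed.

Lemma Z_bil_is_bilinear :
  bilinear_for *:%R *:%R Z_bil.
Proof.
split=> [y a x x' | x a y y'] /=; rewrite /Z_bil.
- rewrite (smul_bilinear.1 y a x x') !linearPr linearPl /=.
  by rewrite opprD !scalerDr scalerN [X in X + (- _ - _) = _]addrACA [LHS]addrACA.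
- rewrite (smul_bilinear.2 x a y y') linearPr !linearPl /=.
  by rewrite opprD !scalerDr scalerN [X in X + (- _ - _) = _]addrACA [LHS]addrACA.
Qed.

HB.instance Definition _ :=
  bilinear_isBilinear.Build k A A A2 _ _ W_bil W_bil_is_bilinear.
HB.instance Definition _ :=
  bilinear_isBilinear.Build k A A A2 _ _ X_bil X_bil_is_bilinear.
HB.instance Definition _ :=
  bilinear_isBilinear.Build k A A A2 _ _ Z_bil Z_bil_is_bilinear.

Definition Wmap : {linear A2 -> A2} := tlift W_bil.
Definition Xmap : {linear A2 -> A2} := tlift X_bil.
Definition Zmap : {linear A2 -> A2} := tlift Z_bil.

Lemma WmapE (i j : 'Z_2) (x y : A) : x \in superdeg i -> y \in superdeg j ->
  Wmap (x ⊗t y) = ⟨x, y⟩ ⊗t one + supersign k i j *: (x ⊗t y).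
Proof.
move=> xi yj; transitivity (W_bil x y); first exact: tliftE.
rewrite /W_bil (bigD1 i) //= (bigD1 j) //= !big1 ?addr0.
- by rewrite (supercomp_homog i xi) (supercomp_homog j yj) !eqxx.
- move=> i' /negPf ni; rewrite big1 // => j' _.
  by rewrite (supercomp_homog i' xi) ni !linear0l scaler0 addr0.
- move=> j' /negPf nj.
  by rewrite (supercomp_homog j' yj) nj !linear0r linear0l scaler0 addr0.
Qed.

Lemma XmapE (i j : 'Z_2) (x y : A) : x \in superdeg i -> y \in superdeg j ->
  Xmap (x ⊗t y) = one ⊗t ⟨x, y⟩ + supersign k i j *: (x ⊗t y).
Proof.
move=> xi yj; transitivity (X_bil x y); first exact: tliftE.
rewrite /X_bil (bigD1 i) //= (bigD1 j) //= !big1 ?addr0.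
- by rewrite (supercomp_homog i xi) (supercomp_homog j yj) !eqxx.
- move=> i' /negPf ni; rewrite big1 // => j' _.
  by rewrite (supercomp_homog i' xi) ni !linear0l linear0r scaler0 addr0.
- move=> j' /negPf nj.
  by rewrite (supercomp_homog j' yj) nj !linear0r scaler0 addr0.
Qed.

Lemma ZmapE (x y : A) :
  Zmap (x ⊗t y) = one ⊗t (x ** y) + (x ** y) ⊗t one - y ⊗t x.
Proof. exact: tliftE. Qed.

Lemma homog_linear_ext (T : lmodType k) (f g : {linear A2 -> T}) :
  (forall (i j : 'Z_2) (x y : A), x \in superdeg i -> y \in superdeg j ->
     f (x ⊗t y) = g (x ⊗t y)) ->
  f =1 g.
Proof.
move=> fg; apply: tensor_linear_ext => x y.
rewrite -(supercomp_sum x) -(supercomp_sum y).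
rewrite linear_sumlz !linear_sum; apply: eq_bigr => i _.
rewrite linear_sumr !linear_sum; apply: eq_bigr => j _.
by apply: (fg i j); exact: supercomp_deg.
Qed.

End PoissonMaps.

(* Main.v *)
Require Import Defs.
From HB Require Import structures.
From mathcomp Require Import all_boot all_order all_algebra.

Set Implicit Arguments.
Unset Strict Implicit.
Unset Printing Implicit Defensive.

Import GRing.Theory.
Local Open Scope ring_scope.

(** By trilinearity both sides of each Yang-Baxter equation may be compared on
    pure tensors of homogeneous elements. The unit is even, since its even
    component is already a left unit, so super-skew-symmetry gives [{1, x} = 0]
    besides [{x, 1} = 0]; hence all iterated brackets that meet the unit vanish
    and few terms survive. What remains reduces to the super Jacobi identity for
    [[W,W,W]] and [[W,X,X]], to the superderivation rule for [[X,X,Z]], and to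
    associativity for [[Z,Z,Z]], where the grading plays no role. *)

(* Reified Z-linear combinations: an identity between sums of many atoms is
   decided by comparing integer coefficients atom by atom. *)
Inductive zexp := ZVar of nat | ZAdd of zexp & zexp | ZOpp of zexp.

Section ZmoduleReflection.
Variable V : zmodType.

Fixpoint zeval (env : seq V) (e : zexp) : V :=
  match e with
  | ZVar i => env`_i
  | ZAdd e1 e2 => zeval env e1 + zeval env e2
  | ZOpp e1 => - zeval env e1
  end.

Fixpoint zcoef (i : nat) (e : zexp) : int :=
  match e with
  | ZVar j => (i == j)%:Z
  | ZAdd e1 e2 => zcoef i e1 + zcoef i e2
  | ZOpp e1 => - zcoef i e1
  end.

Lemma zevalE env e : zeval env e = \sum_(i < size env) env`_i *~ zcoef i e.
Proof.
elim: e => [j|e1 IH1 e2 IH2|e IH] /=.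
- have [lt_j|le_j] := ltnP j (size env); last first.
    (* A variable beyond the environment evaluates to the default [0], and its coefficient at every
       index of the environment vanishes too. *)
    rewrite nth_default // big1 // => i _.
    by rewrite (negPf (_ : i != j :> nat)) ?mulr0z // ltn_eqF // (leq_trans _ le_j).
  rewrite (bigD1 (Ordinal lt_j)) //= eqxx big1 ?addr0 // => i.
  by rewrite -val_eqE => /negPf /= ->.
- by rewrite IH1 IH2 -big_split; apply: eq_bigr => i _; rewrite mulrzDr.
- by rewrite IH -sumrN; apply: eq_bigr => i _; rewrite mulrNz.
Qed.

Lemma zmod_eq env e1 e2 :
    all (fun i => zcoef i e1 == zcoef i e2) (iota 0 (size env)) ->
  zeval env e1 = zeval env e2.
Proof.
move=> /allP coefE; rewrite !zevalE; apply: eq_bigr => i _.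
by rewrite (eqP (coefE i _)) // mem_iota ltn_ord.
Qed.

End ZmoduleReflection.

Ltac zindex t env :=
  lazymatch env with
  | t :: _ => constr:(O)
  | _ :: ?env' => let i := zindex t env' in constr:(S i)
  end.

Ltac zmem t env :=
  lazymatch env with
  | t :: _ => constr:(true)
  | _ :: ?env' => zmem t env'
  | _ => constr:(false)
  end.

Ltac zatoms t env :=
  lazymatch t with
  | (?a + ?b)%R => let env' := zatoms a env in zatoms b env'
  | (- ?a)%R => zatoms a env
  | _ => lazymatch zmem t env with true => env | false => constr:(t :: env) end
  end.

Ltac zreify t env :=
  lazymatch t with
  | (?a + ?b)%R =>
      let e := zreify a env in let e' := zreify b env in constr:(ZAdd e e')
  | (- ?a)%R => let e := zreify a env in constr:(ZOpp e)
  | _ => let i := zindex t env in constr:(ZVar i)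
  end.

(** Anything but a sum or an opposite is an opaque atom, including [0] and scalar multiples, so
    units and signs must be simplified beforehand. *)
Ltac zmodule :=
  lazymatch goal with
  | |- @eq ?T ?l ?r =>
      let env0 := zatoms l (@nil T) in
      let env := zatoms r env0 in
      let e1 := zreify l env in
      let e2 := zreify r env in
      refine (@zmod_eq _ env e1 e2 _); vm_compute; reflexivity
  end.

(** * Operators acting on two of three tensor legs *)

Section TensorLegs.
Variables (k : fieldType) (V : lmodType k).
Implicit Types (R : {linear (V ⊗ V)%type -> (V ⊗ V)%type}) (x y z : V).

(** Inserting a two-fold tensor into two legs is a linear map, so a value of [R] that is not a pure
    tensor can be expanded term by term. *)
Definition leg23 x (t : (V ⊗ V)%type) : (V ⊗ V ⊗ V)%type :=
  tassocV V V V (x ⊗t t).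

Definition leg13 y (t : (V ⊗ V)%type) : (V ⊗ V ⊗ V)%type :=
  op23 (twist V V) (t ⊗t y).

Lemma leg23_is_linear x : linear (leg23 x).
Proof. by move=> a s t; rewrite /leg23 linearPr linearP. Qed.

Lemma leg13_is_linear y : linear (leg13 y).
Proof. by move=> a s t; rewrite /leg13 linearPl linearP. Qed.

HB.instance Definition _ x := GRing.isLinear.Build k _ _ *:%R (leg23 x)
  (leg23_is_linear x).
HB.instance Definition _ x := GRing.isLinear.Build k _ _ *:%R (leg13 x)
  (leg13_is_linear x).

Lemma leg23E x y z : leg23 x (y ⊗t z) = x ⊗t y ⊗t z.
Proof. exact: tassocVE. Qed.

Lemma op12E R x y z : op12 R (x ⊗t y ⊗t z) = R (x ⊗t y) ⊗t z.
Proof. exact: tmapE. Qed.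

Lemma op23E R x y z : op23 R (x ⊗t y ⊗t z) = leg23 x (R (y ⊗t z)).
Proof. by rewrite /op23 /= tassocE tmapE. Qed.

Lemma leg13E x y z : leg13 y (x ⊗t z) = x ⊗t y ⊗t z.
Proof. by rewrite /leg13 [LHS]op23E twistE leg23E. Qed.

(** The first twist brings [z] next to [x]; the second one, which moves [y] back to the middle, is
    the one built into [leg13]. *)
Lemma op13E R x y z : op13 R (x ⊗t y ⊗t z) = leg13 y (R (x ⊗t z)).
Proof.
have -> : op13 R (x ⊗t y ⊗t z)
    = op23 (twist V V) (op12 R (op23 (twist V V) (x ⊗t y ⊗t z))) by [].
by rewrite [op23 _ (x ⊗t _ ⊗t _)]op23E twistE leg23E [op12 R _]op12E.
Qed.

End TensorLegs.

(** * Reduction to homogeneous pure tensors *)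

Lemma homog_linear_ext3 (k : fieldType) (A : poissonSuperalgType k)
    (T : lmodType k) (f g : {linear (A ⊗ A ⊗ A)%type -> T}) :
  (forall (i j l : 'Z_2) (x y z : A),
     x \in superdeg i -> y \in superdeg j -> z \in superdeg l ->
     f (x ⊗t y ⊗t z) = g (x ⊗t y ⊗t z)) ->
  f =1 g.
Proof.
move=> fg; apply: tensor_linear_ext => t z.
rewrite -(supercomp_sum z) linear_sumr !linear_sum; apply: eq_bigr => l _.
have zl := supercomp_deg l z; move: (supercomp l z) zl => {}z zl.
(* With [z] frozen, both maps are linear in the first two legs, which brings the claim back to two
   tensor factors. *)
have pl (h : {linear (A ⊗ A ⊗ A)%type -> T}) : linear (fun s : (A ⊗ A)%type => h (s ⊗t z)).
  by move=> a s s'; rewrite linearPl linearP.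
pose F (h : {linear (A ⊗ A ⊗ A)%type -> T}) : {linear (A ⊗ A)%type -> T} :=
  HB.pack (fun s : (A ⊗ A)%type => h (s ⊗t z)) (GRing.isLinear.Build _ _ _ _ _ (pl h)).
by apply: (@homog_linear_ext k A T (F f) (F g)) => i j x y xi yj; apply: (fg i j l).
Qed.

Lemma yb_commutator_homog (k : fieldType) (A : poissonSuperalgType k)
    (R S T : {linear (A ⊗ A)%type -> (A ⊗ A)%type}) :
  (forall (i j l : 'Z_2) (x y z : A),
     x \in superdeg i -> y \in superdeg j -> z \in superdeg l ->
     op12 R (op13 S (op23 T (x ⊗t y ⊗t z))) = op23 T (op13 S (op12 R (x ⊗t y ⊗t z)))) ->
  yb_commutator R S T =1 \0.
Proof.
move=> RST t; apply/eqP; rewrite subr_eq0; apply/eqP.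
by apply: (homog_linear_ext3 (f := (op12 R \o op13 S) \o op23 T)
  (g := (op23 T \o op13 S) \o op12 R)).
Qed.

(** * Bicharacter properties of the sign *)

Section Signs.
Variable k : fieldType.
Implicit Types i j l : 'Z_2.

Lemma supersignC i j : supersign k i j = supersign k j i.
Proof. by rewrite /supersign mulnC. Qed.

Lemma supersign0r i : supersign k i 0 = 1.
Proof. by rewrite /supersign muln0. Qed.

Lemma supersign0l i : supersign k 0 i = 1.
Proof. by []. Qed.

(** The degree [j + l] is reduced modulo 2, so the two exponents agree only in parity, which is all
    that a power of -1 sees. *)
Lemma supersignDr i j l : supersign k i (j + l) = supersign k i j * supersign k i l.
Proof.
rewrite /supersign -exprD -mulnDr -[LHS]signr_odd -[RHS]signr_odd !oddM.
by case: j l => [[|[]]] // ? [[|[]]].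
Qed.

Lemma supersignDl i j l : supersign k (i + j) l = supersign k i l * supersign k j l.
Proof. by rewrite !(supersignC _ l) supersignDr. Qed.

Variant supersign_spec : k -> Prop :=
  | SupersignPos : supersign_spec 1
  | SupersignNeg : supersign_spec (- 1).

Lemma supersignP i j : supersign_spec (supersign k i j).
Proof. by rewrite /supersign -signr_odd; case: odd; constructor. Qed.

End Signs.

(** * The unit, and the three operators on pure tensors *)

Section Poisson.
Variables (k : fieldType) (A : poissonSuperalgType k) (one : A).
Hypothesis one_unit : forall x : A, one ** x = x /\ x ** one = x.
Hypothesis bracket_one : forall x : A, ⟨x, one⟩ = 0.

Let mul1 (x : A) : one ** x = x := (one_unit x).1.
Let mulone (x : A) : x ** one = x := (one_unit x).2.

(* The even component of the unit is a left unit on homogeneous elements,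
   hence on all elements, hence equal to the unit. *)
Lemma unit_even : one \in superdeg 0.
Proof.
suff e1 x : supercomp 0 one ** x = x.
  by rewrite -(e1 one) mulone supercomp_deg.
rewrite -[X in _ ** X]supercomp_sum -[RHS]supercomp_sum linear_sumr /=.
apply: eq_bigr => i _; have xi := supercomp_deg i x.
move: (supercomp i x) xi => {}x xi.
transitivity (supercomp i (one ** x)); last by rewrite mul1 (supercomp_homog i xi) eqxx.
rewrite -[in RHS](supercomp_sum one) linear_sumlz linear_sum /=.
(* The degree [j] component of the unit times [x] has degree [j + i], which equals [i] only for
   [j = 0]. *)
rewrite (bigD1 0) //= big1 => [|j /negPf j0];
  rewrite (supercomp_homog i (smul_deg _ _ _ _ (supercomp_deg _ _) xi)).
  by rewrite add0r eqxx addr0.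
by rewrite eq_sym -subr_eq0 addrK j0.
Qed.

Lemma one_bracket i x : x \in superdeg i -> ⟨one, x⟩ = 0.
Proof. by move=> xi; rewrite (sbracket_skew _ _ _ _ unit_even xi) bracket_one scaler0 oppr0. Qed.

Local Notation A3 := (A ⊗ A ⊗ A)%type.
Local Notation W := (Wmap one).
Local Notation X := (Xmap one).
Local Notation Z := (Zmap one).

(** A constant of its own lets linearity in each of the three slots be a single rewrite rule. *)
Definition tpure3 (x y z : A) : A3 := x ⊗t y ⊗t z.
Local Notation "[ x , y , z ]" := (tpure3 x y z).

Lemma tpure3Dl x x' y z : [x + x', y, z] = [x, y, z] + [x', y, z].
Proof. by rewrite /tpure3 !linearDl. Qed.
Lemma tpure3Dm x y y' z : [x, y + y', z] = [x, y, z] + [x, y', z].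
Proof. by rewrite /tpure3 linearDr linearDl. Qed.
Lemma tpure3Dr x y z z' : [x, y, z + z'] = [x, y, z] + [x, y, z'].
Proof. by rewrite /tpure3 linearDr. Qed.
Lemma tpure3Nl x y z : [- x, y, z] = - [x, y, z].
Proof. by rewrite /tpure3 !linearNl. Qed.
Lemma tpure3Nm x y z : [x, - y, z] = - [x, y, z].
Proof. by rewrite /tpure3 linearNr linearNl. Qed.
Lemma tpure3Nr x y z : [x, y, - z] = - [x, y, z].
Proof. by rewrite /tpure3 linearNr. Qed.
Lemma tpure3Zl a x y z : [a *: x, y, z] = a *: [x, y, z].
Proof. by rewrite /tpure3 !linearZl_LR. Qed.
Lemma tpure3Zm a x y z : [x, a *: y, z] = a *: [x, y, z].
Proof. by rewrite /tpure3 linearZr_LR linearZl_LR. Qed.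
Lemma tpure3Zr a x y z : [x, y, a *: z] = a *: [x, y, z].
Proof. by rewrite /tpure3 linearZr_LR. Qed.
Lemma tpure30l y z : [0, y, z] = 0.
Proof. by rewrite /tpure3 !linear0l. Qed.
Lemma tpure30m x z : [x, 0, z] = 0.
Proof. by rewrite /tpure3 linear0r linear0l. Qed.
Lemma tpure30r x y : [x, y, 0] = 0.
Proof. by rewrite /tpure3 linear0r. Qed.

Let tpure3E := (tpure3Dl, tpure3Dm, tpure3Dr, tpure3Nl, tpure3Nm, tpure3Nr,
  tpure3Zl, tpure3Zm, tpure3Zr, tpure30l, tpure30m, tpure30r).

Let opD (f : {linear A3 -> A3}) u v : f (u + v) = f u + f v.
Proof. exact: linearD. Qed.

Let opN (f : {linear A3 -> A3}) u : f (- u) = - f u.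
Proof. exact: linearN. Qed.

Let opZ (f : {linear A3 -> A3}) a u : f (a *: u) = a *: f u.
Proof. exact: linearZ. Qed.

Let op0 (f : {linear A3 -> A3}) : f 0 = 0.
Proof. exact: linear0. Qed.

Local Notation op_linear f := (op0 f, opD f, opN f, opZ f).

Section Homogeneous.
Variables (i j : 'Z_2) (x y : A).
Hypotheses (xi : x \in superdeg i) (yj : y \in superdeg j).

Lemma W12E z : op12 W [x, y, z] = [⟨x, y⟩, one, z] + supersign k i j *: [x, y, z].
Proof. by rewrite [LHS]op12E (WmapE _ xi yj) linearDl linearZl_LR. Qed.

Lemma W13E z : op13 W [x, z, y] = [⟨x, y⟩, z, one] + supersign k i j *: [x, z, y].
Proof. by rewrite [LHS]op13E (WmapE _ xi yj) linearD linearZ /= !leg13E. Qed.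

Lemma W23E z : op23 W [z, x, y] = [z, ⟨x, y⟩, one] + supersign k i j *: [z, x, y].
Proof. by rewrite [LHS]op23E (WmapE _ xi yj) linearD linearZ /= !leg23E. Qed.

Lemma X12E z : op12 X [x, y, z] = [one, ⟨x, y⟩, z] + supersign k i j *: [x, y, z].
Proof. by rewrite [LHS]op12E (XmapE _ xi yj) linearDl linearZl_LR. Qed.

Lemma X13E z : op13 X [x, z, y] = [one, z, ⟨x, y⟩] + supersign k i j *: [x, z, y].
Proof. by rewrite [LHS]op13E (XmapE _ xi yj) linearD linearZ /= !leg13E. Qed.

Lemma X23E z : op23 X [z, x, y] = [z, one, ⟨x, y⟩] + supersign k i j *: [z, x, y].
Proof. by rewrite [LHS]op23E (XmapE _ xi yj) linearD linearZ /= !leg23E. Qed.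

End Homogeneous.

Lemma Z12E x y z : op12 Z [x, y, z] = [one, x ** y, z] + [x ** y, one, z] - [y, x, z].
Proof. by rewrite [LHS]op12E ZmapE linearBl linearDl. Qed.

Lemma Z13E x y z : op13 Z [x, z, y] = [one, z, x ** y] + [x ** y, z, one] - [y, z, x].
Proof. by rewrite [LHS]op13E ZmapE linearB linearD /= !leg13E. Qed.

Lemma Z23E x y z : op23 Z [z, x, y] = [z, one, x ** y] + [z, x ** y, one] - [z, y, x].
Proof. by rewrite [LHS]op23E ZmapE linearB linearD /= !leg23E. Qed.

Lemma yb_commutator_ZZZ : yb_commutator Z Z Z =1 \0.
Proof.
apply: yb_commutator_homog => _ _ _ x y z _ _ _; rewrite -/(tpure3 x y z).
rewrite Z23E Z12E !(op_linear (op13 Z)) !Z13E.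
rewrite !(op_linear (op12 Z)) !(op_linear (op23 Z)) !Z23E !Z12E.
(* Unit laws and left-association turn equal products into identical atoms. *)
rewrite !(mul1, mulone, smulA).
zmodule.
Qed.

Let signE := (supersign0l k, supersign0r k, supersignDl k, supersignDr k).

(** Once [signE] has split the signs of sums of degrees, only three pairwise signs remain; fixing
    each to 1 or -1 leaves identities with integer coefficients. *)
Ltac signs i j l :=
  rewrite ?(supersignC k j i) ?(supersignC k l i) ?(supersignC k l j);
  case: (supersignP k i j); case: (supersignP k i l); case: (supersignP k j l);
  rewrite ?(mulN1r, mul1r, mulr1, mulrN1, opprK, scaleN1r, scale1r, scaler0, oppr0, addr0, add0r).

(** * The three identities that involve signs *)

Section HomogeneousTriple.
Variables (i j l : 'Z_2) (x y z : A).
Hypotheses (xi : x \in superdeg i) (yj : y \in superdeg j) (zl : z \in superdeg l).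

Let xy := sbracket_deg _ _ _ _ xi yj.
Let xz := sbracket_deg _ _ _ _ xi zl.
Let yz := sbracket_deg _ _ _ _ yj zl.
Let yz' := smul_deg _ _ _ _ yj zl.
Let xyz := sbracket_deg _ _ _ _ xy zl.
Let one0 := unit_even.
Let jacobi := sbracket_jacobi _ _ _ _ _ _ xi yj zl.
(* The restated type fixes the structure path of the product, which differs
   syntactically in the type of [sbracket_superder]. *)
Let superder : ⟨x, y ** z⟩ = ⟨x, y⟩ ** z + supersign k i j *: (y ** ⟨x, z⟩) :=
  sbracket_superder _ _ _ _ _ _ xi yj zl.
Let skew_xz_y := sbracket_skew _ _ _ _ xz yj.

(** In the terms [[_, one, one]], the left side has [⟨x, ⟨y, z⟩⟩ + (-1)^(jl) ⟨⟨x, z⟩, y⟩] and the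
    right side [⟨⟨x, y⟩, z⟩]. Skew-symmetry turns the second bracket into [-(-1)^(ij) ⟨y, ⟨x, z⟩⟩],
    and this is Jacobi. *)
Lemma WWW_homog :
  op12 W (op13 W (op23 W [x, y, z])) = op23 W (op13 W (op12 W [x, y, z])).
Proof.
rewrite (W23E yj zl) (W12E xi yj) !(op_linear (op13 W)).
rewrite (W13E xi one0) !(W13E xi zl) (W13E xy zl) bracket_one tpure30l.
rewrite !(op_linear (op12 W)) !(op_linear (op23 W)).
rewrite (W12E xi yz) (W12E xz yj) (W12E xi yj).
rewrite (W23E one0 one0) (W23E one0 zl) (W23E yj one0) (W23E yj zl).
rewrite jacobi skew_xz_y !bracket_one (one_bracket zl) !tpure3E !signE.
by signs i j l; zmodule.
Qed.

(** Jacobi is read off the terms [[one, one, _]]: the left side contributes [⟨x, ⟨y, z⟩⟩], the right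
    side the two other nested brackets. *)
Lemma WXX_homog :
  op12 W (op13 X (op23 X [x, y, z])) = op23 X (op13 X (op12 W [x, y, z])).
Proof.
rewrite (X23E yj zl) (W12E xi yj) !(op_linear (op13 X)).
rewrite (X13E xi yz) !(X13E xi zl) (X13E xy zl) !(op_linear (op12 W)) !(op_linear (op23 X)).
rewrite (W12E one0 one0) (W12E xi one0) (W12E one0 yj) (W12E xi yj).
rewrite (X23E one0 xyz) (X23E one0 zl) (X23E yj xz) (X23E yj zl).
rewrite jacobi !bracket_one (one_bracket xyz) (one_bracket yj) (one_bracket zl) !tpure3E !signE.
by signs i j l; zmodule.
Qed.

(** The bracket [⟨x, y ** z⟩] occurs on the left in both [[one, one, _]] and [[one, _, one]]; the
    superderivation rule matches each with two products on the right. *)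
Lemma XXZ_homog :
  op12 X (op13 X (op23 Z [x, y, z])) = op23 Z (op13 X (op12 X [x, y, z])).
Proof.
rewrite Z23E (X12E xi yj) !(op_linear (op13 X)).
rewrite (X13E xi yz') (X13E xi one0) (X13E xi yj) (X13E one0 zl) (X13E xi zl).
rewrite bracket_one (one_bracket zl) !tpure3E.
rewrite !(op_linear (op12 X)) !(op_linear (op23 Z)) !Z23E.
rewrite (X12E one0 one0) (X12E xi one0) (X12E xi yz') (X12E one0 zl) (X12E xi zl).
rewrite superder !bracket_one (one_bracket zl) !tpure3E !signE.
by signs i j l; zmodule.
Qed.

End HomogeneousTriple.
End Poisson.

Theorem theorem5p2 (k : fieldType) (A : poissonSuperalgType k) (one : A)
    (one_unit : forall x : A, one ** x = x /\ x ** one = x)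
    (bracket_one : forall x : A, ⟨x, one⟩ = 0) :
  WXZ_system (Wmap one) (Xmap one) (Zmap one).
Proof.
split; last 2 first.
- by apply: yb_commutator_homog => i j l x y z; apply: WXX_homog.
- by apply: yb_commutator_homog => i j l x y z; apply: XXZ_homog.
- by apply: yb_commutator_homog => i j l x y z; apply: WWW_homog.
- exact: yb_commutator_ZZZ.
Qed.
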